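(* Let $N\ge 1$ be an integer, let $p\in(0,1)$, and let $\{S_n\}_{0\le n\le N}$ be a Bernoulli random walk with parameter $p$, with running maximum $M_n=\max\{S_0,\dots,S_n\}$. Let $f:\{0,1,\dots,N\}\to\mathbb{R}$ be nonincreasing and convex, and consider the optimal stopping problem $$\sup_{0\le\tau\le N}\mathrm{E}[f(M_N-S_\tau)],$$ where the supremum is over all stopping times $\tau\le N$ adapted to the natural filtration of $\{S_k\}_{0\le k\le N}$. (i) If $p\le 1/2$, the rule $\tau\equiv 0$ is optimal. (ii) If $p\ge 1/2$, the rule $\tau\equiv N$ is optimal. (iii) If $p=1/2$, any stopping time $\tau\leq N$ satisfying, almost surely, $S_\tau=M_\tau$ or $\tau=N$ is optimal.
   Context: A Bernoulli random walk with parameter $p\in(0,1)$ is the process $S_0\equiv 0$, $S_n=X_1+\dots+X_n$ for $n\ge1$, where $X_1,X_2,\dots$ are i.i.d. with $\mathrm{P}(X_1=1)=p$ and $\mathrm{P}(X_1=-1)=q:=1-p$. A function $f:\{0,1,\dots,N\}\to\mathbb{R}$ is convex if $f(k)-2f(k+1)+f(k+2)\ge 0$ for all $0\le k\le N-2$. A stopping time (rule) is optimal if it attains the supremum in the optimal stopping problem. *)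

(* Defs.v *)
From HB Require Import structures.
From mathcomp Require Import all_boot all_order all_algebra finmap.
From mathcomp Require Import all_classical all_reals all_analysis.

Set Implicit Arguments.
Unset Strict Implicit.
Unset Printing Implicit Defensive.
Import Order.TTheory GRing.Theory Num.Theory.
Import numFieldNormedType.Exports.

Local Open Scope classical_set_scope.
Local Open Scope ring_scope.

Section bernoulli_random_walk.
Context {R : realType} {d : measure_display} {Omega : measurableType d}.
Variable P : probability Omega R.

Definition mutually_independent (D : set nat) (X : nat -> {RV P >-> R}) : Prop :=
  forall (J : {fset nat}), [set` J] `<=` D ->
  forall A : nat -> set R, (forall i, measurable (A i)) ->
    P (\bigcap_(i in [set` J]) (X i @^-1` A i)) =
      (\prod_(i <- J) P (X i @^-1` A i))%E.

(* Steps are indexed from 0: [X i] is the (i+1)-st step of the walk. Only the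
   first [N] steps are constrained. *)
Definition bernoulli_steps (N : nat) (p : R) (X : nat -> {RV P >-> R}) : Prop :=
  mutually_independent [set i | (i < N)%N] X /\
  forall i, (i < N)%N ->
    P (X i @^-1` [set 1]) = p%:E /\ P (X i @^-1` [set -1]) = (1 - p)%:E.

Definition walk (X : nat -> {RV P >-> R}) (n : nat) (w : Omega) : R :=
  \sum_(i < n) X i w.

Definition running_max (S : nat -> Omega -> R) (n : nat) (w : Omega) : R :=
  \big[Order.max/S 0%N w]_(k < n.+1) S k w.

Definition natural_filtration (S : nat -> Omega -> R) (n : nat) : set_system Omega :=
  <<s [set A | exists2 k, (k <= n)%N &
               exists2 B : set R, measurable B & A = S k @^-1` B] >>.

Definition stopping_time (N : nat) (F : nat -> set_system Omega)
    (tau : Omega -> nat) : Prop :=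
  (forall w, (tau w <= N)%N) /\
  (forall n, (n <= N)%N -> F n [set w | (tau w <= n)%N]).

(* [running_max S N w - S (tau w) w] is nonnegative as soon as [tau w <= N];
   almost surely it is an integer of {0, ..., N}, which [Num.truncn] returns as
   a [nat]. *)
Definition expected_payoff (N : nat) (f : nat -> R) (S : nat -> Omega -> R)
    (tau : Omega -> nat) : \bar R :=
  'E_P[fun w => f (Num.truncn (running_max S N w - S (tau w) w))]%E.

Definition value (N : nat) (f : nat -> R) (S : nat -> Omega -> R) : \bar R :=
  ereal_sup [set expected_payoff N f S tau |
             tau in stopping_time N (natural_filtration S)].

Definition optimal (N : nat) (f : nat -> R) (S : nat -> Omega -> R)
    (tau : Omega -> nat) : Prop :=
  stopping_time N (natural_filtration S) tau /\
  expected_payoff N f S tau = value N f S.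

End bernoulli_random_walk.

Section functions_on_initial_segment.
Context {R : realType}.
Variables (N : nat) (f : nat -> R).

(* A function on {0, ..., N} is a function on [nat] whose values beyond [N] are
   arbitrary. *)
Definition nonincreasing_upto : Prop :=
  forall i j, (i <= j)%N -> (j <= N)%N -> f j <= f i.

Definition convex_upto : Prop :=
  forall k, (k.+2 <= N)%N -> 0 <= f k - 2 * f k.+1 + f k.+2.

End functions_on_initial_segment.

(* Main.v *)
Require Import Defs.
From mathcomp Require Import all_boot all_order all_algebra.
From mathcomp Require Import finmap zify ring lra.
From mathcomp Require Import all_classical all_reals all_analysis.
From mathcomp Require Import measurable_realfun.
Import Order.TTheory GRing.Theory Num.Theory.
Import numFieldNormedType.Exports.
Local Open Scope classical_set_scope.
Local Open Scope ring_scope.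

(** Write [q = 1 - p]. Extending [f] by its value at [N], it may be assumed
    nonincreasing and convex on all of [nat]. Stopping with [k] steps left,
    when the current maximum exceeds the position by [y], is worth
    [G_p k y = E f (max y M_k)], with [M_k] the maximum of a fresh walk, and
    the gap [y] itself evolves as a walk reflected at 0: an up step sends [y] to [y - 1],
    truncated at 0, and a down step sends it to [y + 1]. By the strong Markov
    property ([strong_markov]), the payoff of a stopping rule is the mean of
    [G_p] at the stopped gap, so everything reduces to comparing [G_p] with
    functions that are harmonic or superharmonic for the gap chain.

    The comparison functions come from the reflected walk that moves up with
    probability [p]: let [U_p k y] be the mean of [f] after [k] of its steps,
    started from [y]. Reading the steps backwards (Lindley's identity), this
    walk started at 0 has the law of [M_k], so [U_p k 0 = G_p k 0]. The key
    estimate is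

      [G_p k y <= U_p k y] whenever [p <= 1 / 2]   ([lindley_spread]).

    For [p = 1 / 2] the reflection principle says that both sides are means of
    functions of the end point [S_k], folded onto the half-line by identifying
    [z] with [- 1 - z]; averaging over the sign of [S_k] reduces the estimate to
    convexity of [f] on two nested pairs of points with the same sum. For
    [p <= 1 / 2] the two payoffs are compared path by path: the reflected walk
    is ahead on the paths with [0 <= S_k] and behind on the paths with [S_k <= 0],
    and the weight of a path is a decreasing function of [S_k], so that the
    tilt from 1 / 2 to [p] only favours the paths on which [f] gains.

    The three claims follow by optional stopping.
    - If [p <= 1 / 2], then [U_p] is superharmonic for the gap chain, which
      steps up with the larger probability [q]. Hence no rule does better than
      [U_p N 0 = G_p N 0], the value of stopping at once ([payoff_le_start]).
    - If [1 / 2 <= p], then [U_q] is harmonic for the gap chain and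
      [G_p <= G_q <= U_q], since [G_p] decreases with [p]. Hence no rule does better than
      [U_q N 0], the value of never stopping ([payoff_le_end]).
    - If [p = 1 / 2], then [U_q = G_p] at [y = 0] and at [k = 0], so a rule
      that stops only when the gap is 0 or no step is left loses nothing
      ([payoff_optimal]).

    It remains to pass from the probability space to sign sequences: by
    independence the signs of the steps have the product law, and an event of
    the natural filtration at time [n] cannot separate two outcomes with the
    same first [n] steps, so a stopping time is almost surely a stopping rule
    applied to the signs. *)

(** * Weighted sums over sign sequences *)

Section path_sums.
Context {R : realFieldType}.
Implicit Types (a b p q : R) (k : nat) (F G : seq bool -> R).

(** [true] is an up step. For [a + b = 1] this is the mean of [F] over [k]
    independent steps; the unnormalised case [a = b = 1] is the counting sum to
    which [path_sum_weight] reduces all the others. *)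
Fixpoint path_sum a b k F : R :=
  if k is k'.+1 then
    a * path_sum a b k' (fun s => F (true :: s)) +
    b * path_sum a b k' (fun s => F (false :: s))
  else F [::].

Lemma eq_path_sum {a b k} F G : (forall s, size s = k -> F s = G s) ->
  path_sum a b k F = path_sum a b k G.
Proof.
elim: k F G => [|k IH] F G FG /=; first exact: FG.
by congr (_ * _ + _ * _); apply: IH => s sk; apply: FG; rewrite /= sk.
Qed.

Lemma path_sum_le {a b k} F G : 0 <= a -> 0 <= b ->
  (forall s, size s = k -> F s <= G s) ->
  path_sum a b k F <= path_sum a b k G.
Proof.
move=> a0 b0; elim: k F G => [|k IH] F G FG /=; first exact: FG.
by apply: lerD; apply: ler_wpM2l => //; apply: IH => s sk; apply: FG;
  rewrite /= sk.
Qed.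

Lemma path_sumD a b k F G :
  path_sum a b k (fun s => F s + G s) = path_sum a b k F + path_sum a b k G.
Proof.
elim: k F G => [//|k IH] F G /=.
by rewrite (IH (fun s => F (true :: s))) (IH (fun s => F (false :: s))); ring.
Qed.

Lemma path_sumZ a b k c F :
  path_sum a b k (fun s => c * F s) = c * path_sum a b k F.
Proof.
elim: k F => [//|k IH] F /=.
by rewrite (IH (fun s => F (true :: s))) (IH (fun s => F (false :: s))); ring.
Qed.

Lemma path_sum_const a b k c : a + b = 1 -> path_sum a b k (fun=> c) = c.
Proof. by move=> ab; elim: k => //= k ->; rewrite -mulrDl ab mul1r. Qed.

Lemma path_sum_weight a b k F :
  path_sum a b k F =
  path_sum 1 1 k (fun s => a ^+ count id s * b ^+ count negb s * F s).
Proof.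
elim: k F => [|k IH] F /=; first by rewrite !expr0 !mul1r.
rewrite !mul1r !IH -!path_sumZ.
by congr (_ + _); apply: eq_path_sum => s _;
  rewrite /= ?add0n ?add1n ?exprS; ring.
Qed.

(** * Reflected walks and the maximum of a walk *)

Definition displacement (s : seq bool) : int :=
  (count id s)%:Z - (count negb s)%:Z.

(** Changing all signs permutes the sequences of length [k]. *)
Lemma path_sum_opp k (F : int -> R) :
  path_sum 1 1 k (fun s => F (- displacement s)) =
  path_sum 1 1 k (fun s => F (displacement s)).
Proof.
elim: k F => [|k IH] F; first by rewrite /= /displacement /= subrr oppr0.
rewrite /= !mul1r addrC.
pose up z := F (1 + z); pose down z := F (-1 + z).
transitivity (path_sum 1 1 k (fun s => up (- displacement s)) +
              path_sum 1 1 k (fun s => down (- displacement s))).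
  by congr (_ + _); apply: eq_path_sum => s _; rewrite /up /down; congr F;
    rewrite /displacement /=; lia.
rewrite !IH.
by congr (_ + _); apply: eq_path_sum => s _; rewrite /up /down; congr F;
    rewrite /displacement /=; lia.
Qed.

Definition reflect_step (x : bool) y : nat := if x then y.+1 else y.-1.

(** The reflected walk driven by [s] read from the last step to the first. By
    Lindley's identity [lindley 0 s] is the maximum of the walk with steps [s]:
    prepending a step [x] to a walk changes its maximum [m] into
    [max 0 (x + m)]. *)
Definition lindley y (s : seq bool) : nat := foldr reflect_step y s.

(** The reflected walk from [y] is the free one until it is first pushed back
    at 0; from then on it coincides with the reflected walk from 0. *)
Lemma lindleyE y s :
  lindley y s = maxn (y + count id s - count negb s) (lindley 0 s).
Proof.
elim: s => [|x s IH]; first by rewrite /lindley /=; lia.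
rewrite /lindley /= -!/(lindley _ s) IH.
by case: x; rewrite /reflect_step /=; lia.
Qed.

(** One step of the walk on [nat] reflected at 0, acting on functions. *)
Definition evolve p q (f : nat -> R) y : R := p * f y.+1 + q * f y.-1.

Lemma path_sum_lindley p q k f y :
  path_sum p q k (fun s => f (lindley y s)) = iter k (evolve p q) f y.
Proof.
by elim: k f => [//|k IH] f; rewrite iterSr -IH /= path_sumD !path_sumZ.
Qed.

Lemma evolve_noninc p q f : 0 <= p -> 0 <= q ->
  {homo f : x y / (x <= y)%N >-> y <= x} ->
  forall k, {homo iter k (evolve p q) f : x y / (x <= y)%N >-> y <= x}.
Proof.
move=> p0 q0 f_ni; elim=> [//|k IH] x y xy; rewrite !iterS /evolve.
by apply: lerD; apply: ler_wpM2l => //; apply: IH; lia.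
Qed.

(** Stochastic domination: one step carries nonincreasing functions to
    nonincreasing functions, and its value at such a function decreases with
    the probability of moving up. *)
Lemma evolve_le_prob p p' f k y : 0 <= p -> p <= p' -> p' <= 1 ->
  {homo f : x y / (x <= y)%N >-> y <= x} ->
  iter k (evolve p' (1 - p')) f y <= iter k (evolve p (1 - p)) f y.
Proof.
move=> p0 pp' p'1 f_ni; elim: k y => [//|k IH] y; rewrite !iterS.
have ni := evolve_noninc p (1 - p) f p0 ltac:(lra) f_ni k.
have := ni y.-1 y.+1 ltac:(lia); have := IH y.+1; have := IH y.-1.
rewrite /evolve; set A := iter k _ _ _; set B := iter k _ _ _.
set C := iter k _ _ _; set D := iter k _ _ _ => AB CD DB.
nra.
Qed.

Definition convex_seq (f : nat -> R) :=
  forall k, 0 <= f k - 2 * f k.+1 + f k.+2.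

(** The outer points are moved inward by the same amount [t]; as the slope of
    [f] is nondecreasing, [f v - f (v + t)] is at most [f x - f (x + t)]. *)
Lemma convex_spread f x u v z : convex_seq f ->
  (x <= u)%N -> (x <= v)%N -> (x + z = u + v)%N -> f u + f v <= f x + f z.
Proof.
move=> cf xu xv; have [t ->] : exists t, u = (x + t)%N by exists (u - x)%N; lia.
move=> xz; have {z xz}-> : z = (v + t)%N by lia.
have slope i j : (i <= j)%N -> f j - f j.+1 <= f i - f i.+1.
  move=> /subnKC <-; elim: (j - i)%N => [|n IH]; first by rewrite addn0.
  by apply: le_trans IH; rewrite addnS; have := cf (i + n)%N; lra.
elim: t => [|t IH]; first by rewrite !addn0 addrC.
by have := slope (x + t)%N (v + t)%N ltac:(lia); rewrite !addnS; lra.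
Qed.

(** * The key estimate: reflected walk against maximum *)

(** The quotient map of [int] by the reflection [z |-> - 1 - z], about the
    half-integer that separates [0] from [-1]. *)
Definition fold_int (z : int) : nat :=
  match z with Posz n => n | Negz n => n end.

(** The reflection principle: folding the symmetric free walk gives the walk
    reflected at 0. From each of the points [0] and [-1] over 0, one neighbour
    folds to 1 and the other to 0; on the negative side up and down are
    exchanged, which is harmless because their weights are equal. *)
Lemma evolve_fold k f (z : int) :
  iter k (evolve 1 1) f (fold_int z) =
  path_sum 1 1 k (fun s => f (fold_int (z + displacement s))).
Proof.
elim: k z => [|k IH] z; first by rewrite /= /displacement /= subrr addr0.
transitivity (path_sum 1 1 k (fun s => f (fold_int (z + 1 + displacement s))) +
              path_sum 1 1 k (fun s => f (fold_int (z - 1 + displacement s)))).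
  rewrite -!IH iterS /evolve !mul1r.
  case: z => [n|[|n]].
  - have -> : (n%:Z + 1 = Posz n.+1)%R by lia.
    case: n => [//|n]; have -> // : (n.+1%:Z - 1 = Posz n)%R by lia.
  - have -> : (Negz 0 + 1 = Posz 0)%R by lia.
    have -> : (Negz 0 - 1 = Negz 1)%R by lia.
    by rewrite addrC.
  - have -> : (Negz n.+1 + 1 = Negz n)%R by lia.
    have -> : (Negz n.+1 - 1 = Negz n.+2)%R by lia.
    by rewrite addrC.
by rewrite /= !mul1r; congr (_ + _); apply: eq_path_sum => s _;
  congr f; congr fold_int; rewrite /displacement /=; lia.
Qed.

(** By [evolve_fold] both sides are sums of functions of the displacement, and
    by [path_sum_opp] the displacements [m] and [- m] may be grouped. The pair
    [fold (y + m), fold (y - m)] encloses the pair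
    [max y (fold m), max y (fold (- m))] and has the same sum, so that
    convexity applies. *)
Lemma lindley_spread_uniform k f y : convex_seq f ->
  path_sum 1 1 k (fun s => f (maxn y (lindley 0 s))) <=
  path_sum 1 1 k (fun s => f (lindley y s)).
Proof.
move=> cf; pose g x := f (maxn y x).
rewrite (path_sum_lindley 1 1 k g 0) path_sum_lindley.
rewrite (evolve_fold k g 0) (evolve_fold k f y).
suff : path_sum 1 1 k (fun s => g (fold_int (displacement s)) +
                                g (fold_int (- displacement s))) <=
       path_sum 1 1 k (fun s => f (fold_int (y%:Z + displacement s)) +
                                f (fold_int (y%:Z - displacement s))).
  rewrite !path_sumD (path_sum_opp k (fun z => g (fold_int z))).
  rewrite (path_sum_opp k (fun z => f (fold_int (y%:Z + z)))).
  under [path_sum 1 1 k (fun s => g (fold_int (0 + displacement s)))]eq_path_sum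
    do rewrite add0r.
  lra.
apply: path_sum_le => // s _; rewrite /g.
have main (m : nat) :
    f (maxn y (fold_int m%:Z)) + f (maxn y (fold_int (- m%:Z))) <=
    f (fold_int (y%:Z + m%:Z)) + f (fold_int (y%:Z - m%:Z)).
  have -> : fold_int (y%:Z + m%:Z) = (y + m)%N by [].
  have -> : fold_int m%:Z = m by [].
  have -> : fold_int (- m%:Z) = m.-1 by case: m => [|[]].
  have [my|ym] := leqP m y.
    have -> : (y%:Z - m%:Z = Posz (y - m))%R by lia.
    rewrite -[fold_int (Posz _)]/(y - m)%N.
    have -> : maxn y m.-1 = y by lia.
    by rewrite [leRHS]addrC; apply: convex_spread => //; lia.
  have -> : (y%:Z - m%:Z = Negz (m - y).-1)%R by lia.
  rewrite -[fold_int (Negz _)]/(m - y).-1.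
  have -> : maxn y m.-1 = m.-1 by lia.
  by rewrite [leRHS]addrC; apply: convex_spread => //; lia.
case: (displacement s) => m; first exact: main.
have := main m.+1; rewrite NegzE opprK.
by rewrite addrC [X in _ <= X -> _]addrC.
Qed.

Lemma weight_antitone p q u d u' d' : 0 <= p -> p <= q ->
  (u <= u')%N -> (u + d = u' + d')%N -> p ^+ u' * q ^+ d' <= p ^+ u * q ^+ d.
Proof.
move=> p0 pq /subnKC <-; move: (u' - u)%N => t e.
have {e}-> : d = (t + d')%N by lia.
rewrite !exprD -!mulrA ler_wpM2l ?exprn_ge0 //.
rewrite ler_wpM2r ?exprn_ge0 ?(le_trans p0) //.
by apply: lerXn2r => //; rewrite nnegrE // (le_trans p0).
Qed.

(** The gain [f (lindley y s) - f (max y (lindley 0 s))] is nonnegative when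
    [s] has at least as many down steps as up steps and nonpositive otherwise,
    by [lindleyE]. Its sum with equal weights is nonnegative by the symmetric
    case, and replacing the constant weight [c] by [p ^ #up * q ^ #down]
    increases the weight of the nonnegative gains and decreases that of the
    nonpositive ones. *)
Lemma lindley_spread p q k f y : 0 <= p -> p <= q ->
  {homo f : x y / (x <= y)%N >-> y <= x} -> convex_seq f ->
  path_sum p q k (fun s => f (maxn y (lindley 0 s))) <=
  path_sum p q k (fun s => f (lindley y s)).
Proof.
move=> p0 pq f_ni cf.
pose gain s := f (lindley y s) - f (maxn y (lindley 0 s)).
(* The weight of a balanced path, up to the parity of [k]. *)
pose c := p ^+ (k./2) * q ^+ (k - k./2).
have sumB a b : path_sum a b k gain =
    path_sum a b k (fun s => f (lindley y s)) -
    path_sum a b k (fun s => f (maxn y (lindley 0 s))).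
  rewrite -[X in _ - X]mul1r -mulNr -path_sumZ -path_sumD.
  by apply: eq_path_sum => s _; rewrite mulN1r.
rewrite -subr_ge0 -sumB path_sum_weight.
have : 0 <= c * path_sum 1 1 k gain.
  apply: mulr_ge0; first by rewrite mulr_ge0 // exprn_ge0 // (le_trans p0).
  by rewrite sumB subr_ge0; exact: lindley_spread_uniform.
move=> /le_trans; apply; rewrite -path_sumZ.
apply: path_sum_le => // s sk.
have cnt : (count id s + count negb s = k)%N by rewrite -sk -(count_predC id).
have E := lindleyE y s.
have [ud|du] := leqP (count id s) (count negb s).
  apply: ler_wpM2r; last by apply: weight_antitone => //; lia.
  by rewrite subr_ge0; apply: f_ni; lia.
apply: ler_wnM2r; last by apply: weight_antitone => //; lia.
by rewrite subr_le0; apply: f_ni; lia.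
Qed.

(** * Optional stopping for the gap chain *)

(** Maximum minus position of the walk with steps [s], the maximum including an
    earlier one that exceeds the starting position by [y]. *)
Definition gap y (s : seq bool) : nat :=
  foldl (fun z x => reflect_step (~~ x) z) y s.

(** Final maximum minus position at time [n]; the identification is
    [final_gapE]. *)
Definition final_gap y s n : nat :=
  maxn (gap y (take n s)) (lindley 0 (drop n s)).

Definition stopping_rule k (t : seq bool -> nat) : Prop :=
  (forall s, size s = k -> (t s <= k)%N) /\
  forall s s' n, size s = k -> size s' = k -> take n s = take n s' ->
    (t s <= n)%N = (t s' <= n)%N.

Lemma stopping_rule_zero k t s : stopping_rule k t -> size s = k -> t s = 0%N ->
  forall s', size s' = k -> t s' = 0%N.
Proof.
move=> [_ na] sk ts s' s'k; have := na s s' 0%N sk s'k.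
by rewrite !take0 ts => /(_ erefl)/esym; rewrite leqn0 => /eqP.
Qed.

Lemma stopping_rule_next k t x : stopping_rule k.+1 t ->
  (forall s, size s = k.+1 -> t s <> 0%N) ->
  stopping_rule k (fun s => (t (x :: s)).-1).
Proof.
move=> [tk na] t0; split=> [s sk|s s' n sk s'k ss'].
  by have := tk (x :: s); rewrite /= sk => /(_ erefl); lia.
have xsk u : size u = k -> size (x :: u) = k.+1 by move=> /= ->.
have := na _ _ n.+1 (xsk s sk) (xsk s' s'k); rewrite /= ss' => /(_ erefl).
by have := t0 _ (xsk s sk); have := t0 _ (xsk s' s'k); lia.
Qed.

(** A rule stops at once on all paths or on none; in the second case the first
    step leaves a rule for the remaining steps. *)
Lemma stopping_rule_ind (Q : nat -> nat -> (seq bool -> nat) -> Prop) :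
  (forall k y t, (forall s, size s = k -> t s = 0%N) -> Q k y t) ->
  (forall k y t, (forall s, size s = k.+1 -> t s <> 0%N) ->
    (forall x, Q k (reflect_step (~~ x) y) (fun s => (t (x :: s)).-1)) ->
    Q k.+1 y t) ->
  forall k y t, stopping_rule k t -> Q k y t.
Proof.
move=> Q0 QS; elim=> [|k IH] y t kt.
  by apply: Q0 => s sk; case: kt => /(_ s sk); lia.
have [t0|t0] := eqVneq (t (nseq k.+1 true)) 0%N.
  by apply: Q0; apply: stopping_rule_zero kt _ t0; rewrite size_nseq.
have tn0 s : size s = k.+1 -> t s <> 0%N.
  move=> sk ts; move/eqP: t0; apply; apply: stopping_rule_zero kt sk ts _ _.
  by rewrite size_nseq.
by apply: QS => // x; apply: IH; apply: stopping_rule_next.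
Qed.

Definition stop_value a b f k y : R :=
  path_sum a b k (fun s => f (maxn y (lindley 0 s))).

(** The steps after the stopping time are fresh, so they may be averaged out. *)
Lemma strong_markov a b f : a + b = 1 -> forall k y t, stopping_rule k t ->
  path_sum a b k (fun s => f (final_gap y s (t s))) =
  path_sum a b k (fun s => stop_value a b f (k - t s) (gap y (take (t s) s))).
Proof.
move=> ab; apply: stopping_rule_ind => [k y t t0|k y t t0 IH].
  transitivity (stop_value a b f k y).
    by apply: eq_path_sum => s sk; rewrite t0 // /final_gap take0 drop0.
  rewrite -[LHS](path_sum_const a b k) //.
  by apply: eq_path_sum => s sk; rewrite t0 // take0 subn0.
have next x : path_sum a b k (fun s => f (final_gap y (x :: s) (t (x :: s)))) =
    path_sum a b k (fun s =>
      stop_value a b f (k.+1 - t (x :: s))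
        (gap y (take (t (x :: s)) (x :: s)))).
  have pos s : size s = k -> t (x :: s) = (t (x :: s)).-1.+1.
    by move=> sk; have := t0 (x :: s); rewrite /= sk => /(_ erefl); lia.
  transitivity (path_sum a b k
      (fun s => f (final_gap (reflect_step (~~ x) y) s (t (x :: s)).-1))).
    by apply: eq_path_sum => s sk; rewrite (pos s sk).
  by rewrite IH; apply: eq_path_sum => s sk; rewrite (pos s sk).
by rewrite /= !next.
Qed.

Lemma optional_stopping a b (V : nat -> nat -> R) :
  0 <= a -> 0 <= b -> a + b = 1 ->
  (forall k y, a * V k y.-1 + b * V k y.+1 <= V k.+1 y) ->
  forall k y t, stopping_rule k t ->
  path_sum a b k (fun s => V (k - t s)%N (gap y (take (t s) s))) <= V k y.
Proof.
move=> a0 b0 ab superV; apply: stopping_rule_ind => [k y t t0|k y t t0 IH].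
  rewrite -[leRHS](path_sum_const a b k) // (eq_path_sum _ (fun=> V k y)) //.
  by move=> s sk; rewrite t0 // take0 subn0.
apply: le_trans (superV k y).
have next x : path_sum a b k (fun s =>
      V (k.+1 - t (x :: s))%N (gap y (take (t (x :: s)) (x :: s)))) <=
    V k (reflect_step (~~ x) y).
  apply: le_trans (IH x); rewrite le_eqVlt; apply/orP; left; apply/eqP.
  apply: eq_path_sum => s sk.
  by case: (t (x :: s)) (t0 (x :: s)) => [|n] /=; [rewrite sk => /(_ erefl)|].
by rewrite /=; apply: lerD; apply: ler_wpM2l => //; exact: next.
Qed.

Lemma optional_stopping_harmonic a b (V : nat -> nat -> R) :
  0 <= a -> 0 <= b -> a + b = 1 ->
  (forall k y, a * V k y.-1 + b * V k y.+1 = V k.+1 y) ->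
  forall k y t, stopping_rule k t ->
  path_sum a b k (fun s => V (k - t s)%N (gap y (take (t s) s))) = V k y.
Proof.
move=> a0 b0 ab harmV k y t kt; apply/eqP; rewrite eq_le; apply/andP; split.
  by apply: optional_stopping => // j z; rewrite harmV.
rewrite -lerN2 -mulN1r -path_sumZ.
rewrite (eq_path_sum _ (fun s => - V (k - t s)%N (gap y (take (t s) s))));
  last first.
  by move=> s _; rewrite mulN1r.
apply: (optional_stopping a b (fun k y => - V k y)) => // j z.
by rewrite -harmV opprD !mulrN.
Qed.

(** * Bounds on the payoff of a stopping rule *)

(** Duality between the maximum and the reflected walk: reading independent
    steps backwards does not change their joint law. *)
Lemma stop_now p q f k : stop_value p q f k 0 = iter k (evolve p q) f 0.
Proof.
by rewrite -path_sum_lindley; apply: eq_path_sum => s _; rewrite max0n.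
Qed.

(** Passes through the parameter [1 - p], which is at most 1 / 2: the maximum
    of the walk with parameter [1 - p] is stochastically smaller. *)
Lemma stop_value_le_evolve p f k y : 1 / 2 <= p -> p <= 1 ->
  {homo f : x y / (x <= y)%N >-> y <= x} -> convex_seq f ->
  stop_value p (1 - p) f k y <= iter k (evolve (1 - p) p) f y.
Proof.
move=> ph p1 f_ni cf; rewrite -path_sum_lindley.
have q0 : 0 <= 1 - p by lra.
apply: le_trans (lindley_spread (1 - p) p k f y q0 ltac:(lra) f_ni cf).
rewrite /stop_value.
have g_ni : {homo (fun x => f (maxn y x)) : x z / (x <= z)%N >-> z <= x}.
  by move=> x z xz; apply: f_ni; lia.
rewrite (path_sum_lindley _ _ k (fun x => f (maxn y x)) 0).
rewrite (path_sum_lindley _ _ k (fun x => f (maxn y x)) 0).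
have := evolve_le_prob (1 - p) p _ k 0 q0 ltac:(lra) p1 g_ni.
by rewrite (_ : 1 - (1 - p) = p); last ring.
Qed.

Section stopping_payoff.
Variables (p : R) (f : nat -> R).
Hypotheses (f_ni : {homo f : x y / (x <= y)%N >-> y <= x}) (cf : convex_seq f).

(** The function [iter k (evolve p (1 - p)) f] is superharmonic for the gap
    chain: the latter goes up with probability [1 - p], the larger one, and the
    function is nonincreasing in the gap. *)
Lemma payoff_le_start k t : 0 <= p -> p <= 1 / 2 -> stopping_rule k t ->
  path_sum p (1 - p) k (fun s => f (final_gap 0 s (t s))) <=
  path_sum p (1 - p) k (fun s => f (final_gap 0 s 0)).
Proof.
move=> p0 ph kt; rewrite strong_markov; [|by lra|exact: kt].
have -> : path_sum p (1 - p) k (fun s => f (final_gap 0 s 0)) =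
    iter k (evolve p (1 - p)) f 0.
  rewrite -path_sum_lindley; apply: eq_path_sum => s _.
  by rewrite /final_gap take0 drop0 max0n.
apply: (@le_trans _ _ (path_sum p (1 - p) k (fun s =>
    iter (k - t s) (evolve p (1 - p)) f (gap 0 (take (t s) s))))).
  apply: path_sum_le => [//||s _]; first lra.
  rewrite -path_sum_lindley; apply: lindley_spread => //; lra.
apply: (optional_stopping _ _ (fun k => iter k (evolve p (1 - p)) f)) => //;
  try lra.
move=> j y; rewrite iterS /evolve.
have := evolve_noninc p (1 - p) f p0 ltac:(lra) f_ni j y.-1 y.+1 ltac:(lia).
set A := iter _ _ _ _; set B := iter _ _ _ _ => BA; nra.
Qed.

(** The parameters are exchanged because the gap goes up when the walk goes
    down. *)
Lemma evolve_harmonic j y : p * iter j (evolve (1 - p) p) f y.-1 +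
  (1 - p) * iter j (evolve (1 - p) p) f y.+1 = iter j.+1 (evolve (1 - p) p) f y.
Proof. by rewrite iterS {3}/evolve addrC. Qed.

Lemma payoff_le_end k t : 1 / 2 <= p -> p <= 1 -> stopping_rule k t ->
  path_sum p (1 - p) k (fun s => f (final_gap 0 s (t s))) <=
  iter k (evolve (1 - p) p) f 0.
Proof.
move=> ph p1 kt; rewrite strong_markov; [|by lra|exact: kt].
rewrite -(optional_stopping_harmonic p (1 - p)
  (fun k => iter k (evolve (1 - p) p) f) _ _ _ evolve_harmonic k 0 t kt);
  try lra.
by apply: path_sum_le => [||s _]; rewrite ?stop_value_le_evolve //; lra.
Qed.

(** Equality holds in [payoff_le_end] because the harmonic majorant meets the
    value of stopping at each allowed stopping point: at the final time both
    are [f], and for [p = 1 / 2] at gap 0 both are the same mean by duality. *)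
Lemma payoff_optimal k t : 0 <= p -> p <= 1 -> stopping_rule k t ->
  (forall s, size s = k ->
    t s = k \/ (p = 1 / 2 /\ gap 0 (take (t s) s) = 0%N)) ->
  path_sum p (1 - p) k (fun s => f (final_gap 0 s (t s))) =
  iter k (evolve (1 - p) p) f 0.
Proof.
move=> p0 p1 kt tP; rewrite strong_markov; [|by lra|exact: kt].
rewrite -(optional_stopping_harmonic p (1 - p)
  (fun k => iter k (evolve (1 - p) p) f) _ _ _ evolve_harmonic k 0 t kt);
  try lra.
apply: eq_path_sum => s sk; case: (tP s sk) => [->|[ph ->]].
  by rewrite subnn /stop_value /= maxn0.
by rewrite stop_now; have -> : 1 - p = p by lra.
Qed.

End stopping_payoff.
End path_sums.

(** * Walks, maxima and gaps along a trajectory *)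

Lemma displacement_cons x s : displacement (x :: s) =
  (if x then 1 else -1) + displacement s.
Proof. by case: x; rewrite /displacement /=; lia. Qed.

Lemma displacement_le_peak s k :
  (displacement (take k s) <= (lindley 0 s)%:Z)%R.
Proof.
elim: s k => [//|x s IH] [|k]; first by rewrite take0.
have := IH k; rewrite /= displacement_cons /reflect_step -/(lindley 0 s).
by case: x; lia.
Qed.

Lemma peak_attained s : exists2 k, (k <= size s)%N &
  displacement (take k s) = (lindley 0 s)%:Z.
Proof.
elim: s => [|x s [k ks ke]]; first by exists 0%N.
rewrite /= /reflect_step -/(lindley 0 s).
case: x; last case: (posnP (lindley 0 s)) => [->|l0].
- by exists k.+1 => //=; rewrite displacement_cons ke; lia.
- by exists 0%N.
- by exists k.+1 => //=; rewrite displacement_cons ke; lia.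
Qed.

Lemma final_gapE y s n : (final_gap y s n)%:Z =
  (maxn y (lindley 0 s))%:Z - displacement (take n s).
Proof.
elim: s y n => [|x s IH] y [|n]; rewrite /final_gap ?take0 ?drop0 /=.
- by rewrite /displacement /=; lia.
- by rewrite /displacement /=; lia.
- by rewrite /displacement /=; lia.
have := IH (reflect_step (~~ x) y) n.
rewrite /final_gap /gap displacement_cons => ->.
by case: x; rewrite /reflect_step /= -/(lindley 0 s); lia.
Qed.

Lemma gapE s : (gap 0 s)%:Z = (lindley 0 s)%:Z - displacement s.
Proof.
have := final_gapE 0 s (size s).
by rewrite /final_gap take_size drop_size maxn0 max0n.
Qed.

Lemma final_gap_le y s n : (final_gap y s n <= y + size s)%N.
Proof.
elim: s y n => [|x s IH] y [|n]; rewrite /final_gap ?take0 ?drop0 /=; try lia.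
- have := IH y 0%N.
  rewrite /final_gap take0 drop0 /= /reflect_step -/(lindley 0 s).
  by case: x; lia.
- have := IH (reflect_step (~~ x) y) n; rewrite /final_gap /gap.
  by case: x => /=; lia.
Qed.

Section trajectories.
Context {R : realType} {d : measure_display} {T : measurableType d}.
Context {P : probability T R}.
Variables (X : nat -> {RV P >-> R}) (N : nat).

(** Every value other than 1 counts as a down step, so that the signs are
    defined everywhere; they determine the walk under [unit_steps], which holds
    almost surely. *)
Definition signs (w : T) : seq bool := [seq X i w == 1 | i <- iota 0 N].

Definition unit_steps (w : T) : Prop :=
  forall i, (i < N)%N -> X i w = 1 \/ X i w = -1.

Lemma size_signs w : size (signs w) = N.
Proof. by rewrite size_map size_iota. Qed.

Lemma nth_signs w i : (i < N)%N -> nth false (signs w) i = (X i w == 1).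
Proof.
by move=> iN; rewrite (nth_map 0%N) ?size_iota // nth_iota.
Qed.

Lemma walk_signs w n : unit_steps w -> (n <= N)%N ->
  walk X n w = (displacement (take n (signs w)))%:~R.
Proof.
move=> uw; elim: n => [|n IH] nN; first by rewrite /walk big_ord0 take0.
rewrite /walk big_ord_recr /= -/(walk X n w) IH; last lia.
rewrite (take_nth false) ?size_signs // nth_signs //.
have -> : displacement (rcons (take n (signs w)) (X n w == 1)) =
    displacement (take n (signs w)) + (if X n w == 1 then 1 else -1).
  by rewrite /displacement -cats1 !count_cat /=; case: eqP => _ /=; lia.
rewrite intrD; congr (_ + _).
case: (uw n nN) => ->; rewrite ?eqxx //.
by rewrite -subr_eq0 -opprD -mulr2n oppr_eq0 pnatr_eq0.
Qed.

Lemma running_max_signs w n : unit_steps w -> (n <= N)%N ->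
  running_max (walk X) n w = (lindley 0 (take n (signs w)))%:R.
Proof.
move=> uw nN; set s := take n (signs w).
have sn : size s = n by rewrite size_takel ?size_signs.
have Sk k : (k <= n)%N -> walk X k w = (displacement (take k s))%:~R.
  by move=> kn; rewrite walk_signs ?(leq_trans kn) // /s take_takel.
rewrite /running_max; apply/eqP; rewrite eq_le; apply/andP; split.
  apply: bigmax_le => [|k _].
    by rewrite Sk // take0 ler0n.
  rewrite Sk; last by rewrite -ltnS.
  by rewrite [leRHS]pmulrn ler_int displacement_le_peak.
have [k ks ke] := peak_attained s; rewrite sn in ks.
rewrite -(_ : walk X k w = (lindley 0 s)%:R); last by rewrite Sk // ke.
exact: (le_bigmax _ (fun i : 'I_n.+1 => walk X i w)
  (Ordinal (ks : (k < n.+1)%N))).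
Qed.

Lemma payoff_signs w n f : unit_steps w -> (n <= N)%N ->
  f (Num.truncn (running_max (walk X) N w - walk X n w)) =
  f (minn (final_gap 0 (signs w) n) N) :> R.
Proof.
move=> uw nN; rewrite running_max_signs // walk_signs //.
rewrite take_oversize ?size_signs //.
have := final_gap_le 0 (signs w) n; rewrite size_signs add0n => le.
rewrite (_ : _ - _ = (final_gap 0 (signs w) n)%:R) ?natrK; last first.
  by rewrite [RHS]pmulrn final_gapE max0n mulrzBr -pmulrn.
by rewrite (minn_idPl le).
Qed.

Lemma at_max_signs w n : unit_steps w -> (n <= N)%N ->
  walk X n w = running_max (walk X) n w -> gap 0 (take n (signs w)) = 0%N.
Proof.
move=> uw nN; rewrite running_max_signs // walk_signs // [RHS]pmulrn.
by move=> /intr_inj e; have := gapE (take n (signs w)); lia.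
Qed.

End trajectories.

(** * Stopping times as stopping rules *)

(** The sets that do not separate [w] from [w'] form a sigma-algebra, which
    contains the generators of the filtration at time [n]. *)
Lemma natural_filtration_saturated {R : realType}
    {d : measure_display} {Omega : measurableType d}
    {S : nat -> Omega -> R} {n} {A : set Omega} {w w'} :
  natural_filtration S n A -> (forall k, (k <= n)%N -> S k w = S k w') ->
  A w <-> A w'.
Proof.
move=> nA Sww'; move: A nA; apply: (smallest_sub (C := sigma_algebra setT)
  (X := [set A | A w <-> A w'])).
- split=> [//|A /= Aw|A /= Aw].
  + by split=> -[_ nA]; split=> // /Aw.
  + by split=> -[k _ Ak]; exists k => //; apply/(Aw k).
- by move=> A /= [k kn [B mB ->]]; rewrite /= Sww'.
Qed.

Lemma natural_filtration_measurable (R : realType)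
    (d : measure_display) (Omega : measurableType d)
    (S : nat -> Omega -> R) n (A : set Omega) :
  (forall k, measurable_fun setT (S k)) ->
  natural_filtration S n A -> measurable A.
Proof.
move=> mS; move: A; apply: (smallest_sub (C := sigma_algebra setT)
  (X := measurable)).
  exact: sigma_algebra_measurable.
by move=> A [k kn [B mB ->]]; rewrite -[X in measurable X]setTI; exact: mS.
Qed.

Lemma measurable_fun_select (R : realType) (d : measure_display)
    (T : measurableType d) (tau : T -> nat) (g : nat -> T -> R) :
  (forall n, measurable [set w | (tau w <= n)%N]) ->
  (forall n, measurable_fun setT (g n)) ->
  measurable_fun setT (fun w => g (tau w) w).
Proof.
move=> mtau mg _ B mB; rewrite setTI.
rewrite (_ : _ @^-1` B = \bigcup_n (g n @^-1` B `&`
   ([set w | (tau w <= n)%N] `\`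
     \bigcup_(m in [set m | (m < n)%N]) [set w | (tau w <= m)%N]))).
  apply: bigcup_measurable => n _; apply: measurableI.
    by rewrite -[X in measurable X]setTI; exact: mg.
  by apply: measurableD => //; apply: bigcup_measurable => m _.
apply/seteqP; split=> [w Bw|w [n _ [Bn [/= wn nw]]]].
  by exists (tau w) => //; split=> //; split=> //= -[m /= mw]; lia.
suff tn : tau w = n by rewrite /preimage /= tn.
apply/eqP; rewrite eqn_leq wn leqNgt; apply/negP => wn'.
by apply: nw; exists (tau w) => /=.
Qed.

Lemma measurable_fun_truncn (R : realType) (d : measure_display)
    (T : measurableType d) (r : T -> R) (f : nat -> R) :
  measurable_fun setT r -> measurable_fun setT (fun w => f (Num.truncn (r w))).
Proof.
move=> mr; apply: (measurable_fun_select _ _ _ _ (fun n => cst (f n))) => // n.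
rewrite (_ : [set _ | _] = setT `&` r @^-1` `]-oo, n.+1%:R[); first exact: mr.
by rewrite setTI; apply/seteqP; split=> w /=; rewrite truncn_le_nat in_itv.
Qed.

Section walk_probability.
Context {R : realType} {d : measure_display} {Omega : measurableType d}.
Context {P : probability Omega R}.
Variables (X : nat -> {RV P >-> R}) (N : nat).

Lemma measurable_walk n : measurable_fun setT (walk X n).
Proof. by apply: measurable_sum => i; exact: measurable_funPT. Qed.

Lemma measurable_running_max n : measurable_fun setT (running_max (walk X) n).
Proof.
rewrite /running_max.
elim: (index_enum _) => [|i s IH].
  under eq_fun do rewrite big_nil; exact: measurable_walk.
under eq_fun do rewrite big_cons.
by apply: measurable_maxr => //; exact: measurable_walk.
Qed.

Lemma stopping_time_measurable tau n :
  stopping_time N (natural_filtration (walk X)) tau ->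
  measurable [set w | (tau w <= n)%N].
Proof.
move=> [tauN mtau]; have [nN|Nn] := leqP n N.
  apply: natural_filtration_measurable (mtau n nN); exact: measurable_walk.
rewrite (_ : [set _ | _] = setT) //.
by apply/seteqP; split=> w //= _; rewrite (leq_trans (tauN w)) // ltnW.
Qed.

Lemma measurable_payoff f tau :
  stopping_time N (natural_filtration (walk X)) tau ->
  measurable_fun setT (fun w =>
    f (Num.truncn (running_max (walk X) N w - walk X (tau w) w)) : R).
Proof.
move=> st; apply: (measurable_fun_select _ _ _ tau (fun n w =>
    f (Num.truncn (running_max (walk X) N w - walk X n w)))) => n.
  exact: stopping_time_measurable.
apply: measurable_fun_truncn; apply: measurable_funB.
  exact: measurable_running_max.
exact: measurable_walk.
Qed.

(** Two outcomes with the same first [n] unit steps are in the same events of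
    the filtration at time [n]. Hence the stopping time is a function of the
    signs, and, each sign sequence being realized, this function is
    nonanticipating on all of them. *)
Lemma stopping_time_rule tau :
  stopping_time N (natural_filtration (walk X)) tau ->
  (forall s, size s = N -> exists2 w, unit_steps X N w & signs X N w = s) ->
  exists2 t, stopping_rule N t &
    forall w, unit_steps X N w -> tau w = t (signs X N w).
Proof.
move=> [tauN mtau] real.
have agree w w' n : unit_steps X N w -> unit_steps X N w' -> (n <= N)%N ->
    take n (signs X N w) = take n (signs X N w') ->
    (tau w <= n)%N = (tau w' <= n)%N.
  move=> uw uw' nN e; have walkE k : (k <= n)%N -> walk X k w = walk X k w'.
    move=> kn; rewrite !(walk_signs X N) ?(leq_trans kn) //.
    by rewrite -(take_takel _ kn) e take_takel.
  have [ww' w'w] := natural_filtration_saturated (mtau n nN) walkE.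
  by apply/idP/idP.
have ext w w' : unit_steps X N w -> unit_steps X N w' ->
    signs X N w = signs X N w' -> tau w = tau w'.
  move=> uw uw' e; apply/eqP; rewrite eqn_leq.
  by rewrite (agree w w' (tau w')) ?e // -(agree w w' (tau w)) ?e // !leqnn.
have /choice[t tP] : forall s : seq bool, exists n,
    forall w, unit_steps X N w -> signs X N w = s -> tau w = n.
  move=> s.
  have [[w [uw ws]]|no] :=
    pselect (exists w, unit_steps X N w /\ signs X N w = s).
    by exists (tau w) => w' uw' w's; apply: ext => //; rewrite w's.
  by exists 0%N => w uw ws; case: no; exists w.
exists t; last by move=> w uw; exact: tP.
split=> [s sN|s s' n sN s'N e].
  by have [w uw ws] := real s sN; rewrite -(tP s w).
have [w uw ws] := real s sN; have [w' uw' ws'] := real s' s'N.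
rewrite -(tP s w) // -(tP s' w') //.
have [nN|Nn] := leqP n N; first by apply: agree => //; rewrite ws ws'.
by rewrite !(leq_trans (tauN _)) // ltnW.
Qed.

End walk_probability.

(** * The law of the signs *)

Fixpoint sign_seqs k : seq (seq bool) :=
  if k is k'.+1 then
    [seq true :: s | s <- sign_seqs k'] ++ [seq false :: s | s <- sign_seqs k']
  else [:: [::]].

Lemma mem_sign_seqs k s : (s \in sign_seqs k) = (size s == k).
Proof.
elim: k s => [|k IH] s; first by rewrite inE; case: s.
rewrite /= mem_cat; apply/idP/idP.
  by case/orP => /mapP[s' + ->]; rewrite IH.
case: s => [//|[] s]; rewrite /= eqSS -IH => sk.
  by rewrite map_f.
by rewrite orbC map_f.
Qed.

Lemma uniq_sign_seqs k : uniq (sign_seqs k).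
Proof.
elim: k => [//|k IH] /=.
rewrite cat_uniq !map_inj_uniq ?IH ?andbT /=; last 2 first.
- by move=> s s' [].
- by move=> s s' [].
by apply/hasPn => _ /mapP[s _ ->]; apply/negP => /mapP[].
Qed.

Lemma path_sumE (R : realFieldType) (a b : R) k F : path_sum a b k F =
  \sum_(s <- sign_seqs k) a ^+ count id s * b ^+ count negb s * F s.
Proof.
suff sum1 G : path_sum (1 : R) 1 k G = \sum_(s <- sign_seqs k) G s.
  by rewrite path_sum_weight sum1.
elim: k G => [|k IH] G; first by rewrite /= big_seq1.
by rewrite /= !mul1r !IH big_cat !big_map.
Qed.

Section walk_law.
Context {R : realType} {d : measure_display} {Omega : measurableType d}.
Context {P : probability Omega R}.
Variables (X : nat -> {RV P >-> R}) (N : nat) (p : R).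
Hypothesis X_steps : bernoulli_steps N p X.

Definition sign_set (x : bool) : set R := if x then [set 1] else ~` [set 1].

Lemma measurable_sign_set x : measurable (sign_set x).
Proof. by case: x; rewrite /sign_set //; exact: measurableC. Qed.

Lemma measurable_step i (B : set R) : measurable B -> measurable (X i @^-1` B).
Proof.
by move=> mB; rewrite -[X in measurable X]setTI; exact: measurable_funPT.
Qed.

Lemma step_law i x : (i < N)%N ->
  P (X i @^-1` sign_set x) = (if x then p else 1 - p)%:E.
Proof.
move=> iN; have [Xp _] := X_steps.2 i iN.
by case: x; rewrite /sign_set // -preimage_setC probability_setC ?Xp //.
Qed.

Lemma signs_event s : size s = N -> [set w | signs X N w = s] =
  \bigcap_(i in [set` [fset i | i in iota 0 N]%fset])
    (X i @^-1` sign_set (nth false s i)).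
Proof.
move=> sN; apply/seteqP; split=> w /=.
  move=> <- i /=; rewrite !inE /= mem_iota add0n => iN.
  by rewrite nth_signs // /sign_set; case: eqP.
move=> ws; apply: (@eq_from_nth _ false); rewrite size_signs // => i iN.
rewrite nth_signs //; have := ws i; rewrite /= !inE mem_iota iN => /(_ isT).
by rewrite /sign_set; case: (nth _ _ _) => /= [->|/eqP/negPf]; rewrite ?eqxx.
Qed.

Lemma measurable_signs_event s : measurable [set w | signs X N w = s].
Proof.
have [sN|sN] := eqVneq (size s) N; last first.
  rewrite (_ : [set _ | _] = set0) //; apply/seteqP; split=> w //= ws.
  by rewrite -ws size_signs eqxx in sN.
rewrite signs_event //; apply: bigcap_measurableType => i _.
by apply: measurable_step; exact: measurable_sign_set.
Qed.

Lemma signs_law s : size s = N ->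
  P [set w | signs X N w = s] =
  (p ^+ count id s * (1 - p) ^+ count negb s)%:E.
Proof.
move=> sN; rewrite signs_event // X_steps.1; last 2 first.
- by move=> i /=; rewrite !inE mem_iota.
- by move=> i; exact: measurable_sign_set.
rewrite (perm_big (iota 0 N)); last first.
  apply: uniq_perm; rewrite ?fset_uniq ?iota_uniq // => i.
  by rewrite !inE.
rewrite (eq_big_seq (fun i => (if nth false s i then p else 1 - p)%:E));
  last first.
  by move=> i; rewrite mem_iota => iN; exact: step_law.
rewrite prodEFin; congr EFin; rewrite -sN -[size s]subn0.
rewrite -(big_nth false xpredT (fun x : bool => if x then p else 1 - p)).
elim: (s) => [|[] s' IH]; first by rewrite big_nil !expr0 mul1r.
  by rewrite big_cons IH /= exprS mulrA.
by rewrite big_cons IH /= exprS mulrCA.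
Qed.

Lemma unit_steps_ae : {ae P, forall w, unit_steps X N w}.
Proof.
suff : {ae P, forall w, forall i, (i < N)%N -> X i w = 1 \/ X i w = -1}.
  by [].
apply: ae_foralln => i; have [iN|Ni] := ltnP i N; last first.
  by apply: aeW => w; lia.
have [Xp Xq] := X_steps.2 i iN.
pose A := X i @^-1` [set 1] `|` X i @^-1` [set -1].
have m1 x : measurable (X i @^-1` [set x]) by exact: measurable_step.
have mA : measurable A by exact: measurableU.
have PA : (P A = P (X i @^-1` [set 1%R]) + P (X i @^-1` [set (-1)%R]))%E.
  apply: measureU => //; apply/seteqP; split=> w //= -[Xw1].
  by rewrite Xw1 => /eqP; rewrite -subr_eq0 opprK -mulr2n pnatr_eq0.
have PnA : P (~` A) = 0%E.
  by rewrite probability_setC // PA Xp Xq -EFinD subrKC subrr.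
exists (~` A); split => //; first exact: measurableC.
by move=> w /= nw [w1|w1]; apply: nw => _; [left|right].
Qed.

(** Each sign sequence has positive probability, so it is realized outside any
    given null set. *)
Lemma signs_realized s (Q : Omega -> Prop) : 0 < p -> p < 1 -> size s = N ->
  {ae P, forall w, Q w} ->
  exists w, [/\ unit_steps X N w, signs X N w = s & Q w].
Proof.
move=> p0 p1 sN Qae; apply: contrapT => none.
have : {ae P, forall w, signs X N w <> s}.
  apply: filterS2 unit_steps_ae Qae => w uw Qw ws.
  by apply: none; exists w.
move=> neg; have /eqP : P [set w | signs X N w = s] = 0%E.
  apply: measure_negligible; first exact: measurable_signs_event.
  by apply: negligibleS neg => w /= ws; apply.
rewrite signs_law // eqe mulf_eq0 !expf_eq0 !gt_eqF ?subr_gt0 //.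
by rewrite !andbF.
Qed.

Lemma signs_indicE (H : seq bool -> R) w : H (signs X N w) =
  \sum_(s <- sign_seqs N) H s * \1_[set w | signs X N w = s] w.
Proof.
rewrite (bigD1_seq (signs X N w)) ?uniq_sign_seqs ?mem_sign_seqs
  ?size_signs //=.
rewrite indicE mem_set // mulr1 big1 ?addr0 // => s /eqP sw.
by rewrite indicE memNset ?mulr0 // => /= /esym.
Qed.

Lemma measurable_signs (H : seq bool -> R) :
  measurable_fun setT (fun w => H (signs X N w)).
Proof.
under eq_fun do rewrite signs_indicE.
apply: measurable_sum => s; apply: measurable_funM => //.
by apply: measurable_indic; exact: measurable_signs_event.
Qed.

Lemma expectation_signs (H : seq bool -> R) :
  'E_P[fun w => H (signs X N w)]%E = (path_sum p (1 - p) N H)%:E.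
Proof.
rewrite unlock; under eq_integral do rewrite signs_indicE -sumEFin.
have int s : P.-integrable setT
    (fun w => (\1_[set w | signs X N w = s] w)%:E : \bar R).
  by apply: integrable_indic; exact: measurable_signs_event.
rewrite integral_sum //=; last first.
  by move=> s; under eq_fun do rewrite EFinM; exact: integrableZl.
rewrite path_sumE -sumEFin; apply: eq_big_seq => s.
rewrite mem_sign_seqs => /eqP sN.
under eq_integral do rewrite EFinM.
rewrite integralZl // integral_indic //; last exact: measurable_signs_event.
rewrite setIT.
transitivity ((H s)%:E * P [set w | signs X N w = s])%E => //.
by rewrite signs_law // -EFinM mulrC.
Qed.

(** The two integrands agree on [unit_steps]; measurability of the payoff is
    what allows the null set to be discarded. *)
Lemma expected_payoff_rule f tau t :
  stopping_time N (natural_filtration (walk X)) tau -> stopping_rule N t ->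
  (forall w, unit_steps X N w -> tau w = t (signs X N w)) ->
  expected_payoff P N f (walk X) tau = (path_sum p (1 - p) N
    (fun s => f (minn (final_gap 0 s (t s)) N)))%:E.
Proof.
move=> st rt taut; rewrite -expectation_signs /expected_payoff unlock.
apply: ae_eq_integral => //.
- by apply/measurable_EFinP; exact: measurable_payoff.
- apply/measurable_EFinP.
  exact: (measurable_signs (fun s => f (minn (final_gap 0 s (t s)) N))).
apply: filterS unit_steps_ae => w uw _ /=; congr EFin.
by rewrite (payoff_signs X N w (tau w)) ?st.1 // taut.
Qed.

End walk_law.

(** * The optimal stopping problem *)

Lemma stopping_time_cst (R : realType) (d : measure_display)
    (Omega : measurableType d) (S : nat -> Omega -> R) N n :
  (n <= N)%N -> stopping_time N (natural_filtration S) (fun=> n).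
Proof.
move=> nN; split=> // m _; have [nm|mn] := leqP n m.
  rewrite (_ : [set _ | _] = setT); last by apply/seteqP; split=> w.
  rewrite -(setD0 setT); apply: sigma_algebraCD; exact: sigma_algebra0.
rewrite (_ : mkset _ = set0); last by apply/seteqP; split=> w.
exact: sigma_algebra0.
Qed.

Lemma truncated_noninc (R : realType) N (f : nat -> R) :
  nonincreasing_upto N f ->
  {homo (fun n => f (minn n N)) : x y / (x <= y)%N >-> y <= x}.
Proof. by move=> fN x y xy; apply: fN; lia. Qed.

(** Beyond [N] the truncated function is constant, and at [N] its slope
    increases from a nonpositive value to 0. *)
Lemma truncated_convex (R : realType) N (f : nat -> R) :
  nonincreasing_upto N f -> convex_upto N f ->
  convex_seq (fun n => f (minn n N)).
Proof.
move=> f_ni cf k; have [kN|Nk] := leqP k.+2 N.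
  by rewrite !(minn_idPl _) //; [exact: cf|lia..].
rewrite (_ : minn k.+1 N = N) ?(_ : minn k.+2 N = N); try lia.
by have := f_ni (minn k N) N ltac:(lia) (leqnn N); lra.
Qed.

Theorem theorem1p1 (R : realType) (d : measure_display) (Omega : measurableType d)
    (P : probability Omega R) (N : nat) (p : R) (X : nat -> {RV P >-> R})
    (f : nat -> R)
    (N_ge1 : (1 <= N)%N) (p_gt0 : 0 < p) (p_lt1 : p < 1)
    (X_steps : bernoulli_steps N p X)
    (f_noninc : nonincreasing_upto N f) (f_convex : convex_upto N f) :
  [/\ p <= 1 / 2 -> optimal P N f (walk X) (fun _ => 0%N),
      1 / 2 <= p -> optimal P N f (walk X) (fun _ => N)
    & p = 1 / 2 -> forall tau : Omega -> nat,
        stopping_time N (natural_filtration (walk X)) tau ->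
        {ae P, forall w,
           walk X (tau w) w = running_max (walk X) (tau w) w \/ tau w = N} ->
        optimal P N f (walk X) tau].
Proof.
pose g n := f (minn n N).
have g_ni : {homo g : x y / (x <= y)%N >-> y <= x} by exact: truncated_noninc.
have g_cx : convex_seq g by exact: truncated_convex.
have p0 := ltW p_gt0; have p1 := ltW p_lt1.
have realized s : size s = N ->
    exists2 w, unit_steps X N w & signs X N w = s.
  move=> sN; have [|w [uw ws _]] :=
    signs_realized X N p X_steps s (fun=> True) p_gt0 p_lt1 sN.
    exact: aeW.
  by exists w.
have rule tau : stopping_time N (natural_filtration (walk X)) tau ->
    exists2 t, stopping_rule N t &
      (forall w, unit_steps X N w -> tau w = t (signs X N w)) /\
      expected_payoff P N f (walk X) tau =
        (path_sum p (1 - p) N (fun s => g (final_gap 0 s (t s))))%:E.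
  move=> st; have [t rt taut] := stopping_time_rule X N tau st realized.
  by exists t => //; split=> //; exact: expected_payoff_rule.
have optimal_max tau : stopping_time N (natural_filtration (walk X)) tau ->
    (forall t, stopping_rule N t ->
      ((path_sum p (1 - p) N (fun s => g (final_gap 0 s (t s))))%:E <=
        expected_payoff P N f (walk X) tau)%E) ->
    optimal P N f (walk X) tau.
  move=> st best; split=> //; apply/eqP; rewrite eq_le; apply/andP; split.
    by apply: ereal_sup_ubound; exists tau.
  apply: ge_ereal_sup => _ [tau' st' <-].
  by have [t rt [_ ->]] := rule tau' st'; exact: best.
split.
- move=> ph; have st := stopping_time_cst R d Omega (walk X) N 0 (leq0n N).
  apply: optimal_max => // t rt.
  rewrite (expected_payoff_rule X N p X_steps f _ (fun=> 0%N) st) //.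
  by rewrite lee_fin; exact: payoff_le_start.
- move=> ph; have st := stopping_time_cst R d Omega (walk X) N N (leqnn N).
  apply: optimal_max => // t rt.
  rewrite (expected_payoff_rule X N p X_steps f _ (fun=> N) st) //.
  rewrite lee_fin -/(g _) (payoff_optimal p g N (fun=> N)) //; last first.
    by move=> *; left.
  exact: payoff_le_end.
- move=> ph tau st tau_max; have [t rt [taut payE]] := rule tau st.
  apply: optimal_max => // t' rt'; rewrite payE lee_fin.
  rewrite [leRHS]payoff_optimal //.
    by apply: payoff_le_end => //; rewrite ph.
  move=> s sN.
  have [w [uw ws]] := signs_realized X N p X_steps s _ p_gt0 p_lt1 sN tau_max.
  have tN : (tau w <= N)%N by exact: st.1.
  rewrite -ws -(taut w uw) => -[at_max|]; [right|by left].
  by split=> //; exact: at_max_signs.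
Qed.
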